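(* The fundamental quandle of a linkoid is invariant under the under forbidden move $\Omega_-$: if $L$ and $L'$ are oriented linkoid diagrams that differ by a move $\Omega_-$, then $Q(L)\cong Q(L')$.
   Context: A quandle is a set $X$ with a binary operation $\triangleright$ such that (1) $x\triangleright x=x$ for all $x$; (2) for every $y$ the map $\beta_y:X\to X$, $\beta_y(x)=x\triangleright y$, is bijective; (3) $(x\triangleright y)\triangleright z=(x\triangleright z)\triangleright(y\triangleright z)$ for all $x,y,z$. Write $x\triangleright^{-1}y=\beta_y^{-1}(x)$ and $\triangleright^{1}=\triangleright$. Isomorphisms are bijective maps preserving $\triangleright$. An oriented $n$-linkoid diagram ($n\ge 0$) is a generic immersion into $S^2$ of $n$ unit intervals $[0,1]$ (oriented from $0$ to $1$; the open components) and a number of oriented circles (the closed components), with finitely many transverse double points (crossings), each endowed with over/under information. A linkoid diagram is an $n$-linkoid diagram for some $n$. The image of $0$ in an open component is its leg and the image of $1$ its head; these are the endpoints. Linkoid diagrams are considered up to isotopy in $S^2$ and oriented Reidemeister moves R1, R2, R3 away from the endpoints. The under forbidden move $\Omega_-$ consists of pulling an endpoint under an adjacent strand of the diagram, or the reverse of this: it creates (or removes) one crossing, in which the end piece of an open component next to the endpoint passes under the strand. An arc of a diagram is a maximal piece of a component containing no passage under a crossing (arcs end at undercrossings or endpoints). If $A(L)$ is the set of arcs of $L$, the fundamental quandle $Q(L)$ is the quandle presented by generators $A(L)$ and one relation $r_\tau$ for each crossing $\tau$: if $y$ is the over-arc, $x$ the incoming under-arc, $z$ the outgoing under-arc and $\varepsilon\in\{1,-1\}$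 the sign of the crossing, then $r_\tau$ is $z=x\triangleright^{\varepsilon}y$. *)

(* Defs.v *)
From HB Require Import structures.
From mathcomp Require Import all_boot all_order all_algebra.
From mathcomp Require Import all_classical all_reals all_analysis.
Set Implicit Arguments.
Unset Strict Implicit.
Unset Printing Implicit Defensive.
Import Order.TTheory GRing.Theory Num.Theory.
Import numFieldNormedType.Exports.
Local Open Scope classical_set_scope.
Local Open Scope ring_scope.

Record quandle : Type := Quandle {
  qcarrier :> Type;
  qop : qcarrier -> qcarrier -> qcarrier;
  qop_idem : forall x, qop x x = x;
  qop_bij : forall y, bijective (fun x => qop x y);
  qop_dist : forall x y z, qop (qop x y) z = qop (qop x z) (qop y z) }.

Definition quandle_isomorphic (X Y : quandle) : Prop :=
  exists f : X -> Y,
    bijective f /\ forall x y, f (qop x y) = qop (f x) (f y).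

Inductive qterm (A : Type) : Type :=
| QGen of A
| QOp of qterm A & qterm A
| QOpV of qterm A & qterm A.

(** The congruence on terms generated by the quandle axioms, with [QOpV _ y]
    the inverse of [QOp _ y], and by the pairs of terms in [rel]. *)
Inductive qeq (A : Type) (rel : set (qterm A * qterm A)) :
    qterm A -> qterm A -> Prop :=
| qeq_rel s t : rel (s, t) -> qeq rel s t
| qeq_refl t : qeq rel t t
| qeq_sym s t : qeq rel s t -> qeq rel t s
| qeq_trans s t u : qeq rel s t -> qeq rel t u -> qeq rel s u
| qeq_op s s' t t' :
    qeq rel s s' -> qeq rel t t' -> qeq rel (QOp s t) (QOp s' t')
| qeq_opV s s' t t' :
    qeq rel s s' -> qeq rel t t' -> qeq rel (QOpV s t) (QOpV s' t')
| qeq_idem t : qeq rel (QOp t t) t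
| qeq_opK s t : qeq rel (QOpV (QOp s t) t) s
| qeq_opVK s t : qeq rel (QOp (QOpV s t) t) s
| qeq_dist s t u :
    qeq rel (QOp (QOp s t) u) (QOp (QOp s u) (QOp t u)).

(** Elements of the presented quandle are the classes of [qeq rel]. *)
Definition qclass (A : Type) (rel : set (qterm A * qterm A)) : Type :=
  {C : set (qterm A) | exists t, C = qeq rel t}.

Definition qclass_of (A : Type) (rel : set (qterm A * qterm A))
    (t : qterm A) : qclass rel :=
  exist _ (qeq rel t) (ex_intro _ t erefl).

Definition qclass_repr (A : Type) (rel : set (qterm A * qterm A))
    (C : qclass rel) : qterm A :=
  projT1 (cid (proj2_sig C)).

Definition qclass_op (A : Type) (rel : set (qterm A * qterm A))
    (C D : qclass rel) : qclass rel :=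
  qclass_of rel (QOp (qclass_repr C) (qclass_repr D)).

Lemma qclass_reprK (A : Type) (rel : set (qterm A * qterm A))
  (C : qclass rel) : qclass_of rel (qclass_repr C) = C.
Proof.
case: C => C hC; apply: eq_exist; rewrite /qclass_repr /=.
by case: cid => t /= ->.
Qed.

Lemma qclass_ofP (A : Type) (rel : set (qterm A * qterm A)) (s t : qterm A) :
  qclass_of rel s = qclass_of rel t <-> qeq rel s t.
Proof.
split=> [e|est].
  have /= -> : sval (qclass_of rel s) = sval (qclass_of rel t) by rewrite e.
  exact: qeq_refl.
apply: eq_exist => /=; apply/seteqP; split=> u eu.
  exact: qeq_trans (qeq_sym est) eu.
exact: qeq_trans est eu.
Qed.

Lemma qclass_repr_of (A : Type) (rel : set (qterm A * qterm A)) (t : qterm A) :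
  qeq rel (qclass_repr (qclass_of rel t)) t.
Proof. by apply/qclass_ofP; rewrite qclass_reprK. Qed.

Lemma qclass_opE (A : Type) (rel : set (qterm A * qterm A)) (s t : qterm A) :
  qclass_op (qclass_of rel s) (qclass_of rel t) = qclass_of rel (QOp s t).
Proof. by apply/qclass_ofP/qeq_op; apply: qclass_repr_of. Qed.

Lemma qclass_op_idem (A : Type) (rel : set (qterm A * qterm A))
  (C : qclass rel) : qclass_op C C = C.
Proof.
rewrite -(qclass_reprK C) qclass_opE; apply/qclass_ofP; exact: qeq_idem.
Qed.

Lemma qclass_op_bij (A : Type) (rel : set (qterm A * qterm A))
  (D : qclass rel) : bijective (fun C => qclass_op C D).
Proof.
exists (fun C => qclass_of rel (QOpV (qclass_repr C) (qclass_repr D))) => C /=.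
  rewrite -[RHS]qclass_reprK; apply/qclass_ofP.
  apply: qeq_trans (qeq_opK _ _ (qclass_repr D)).
  by apply: qeq_opV (qeq_refl _ _); apply: qclass_repr_of.
rewrite -[RHS]qclass_reprK; apply/qclass_ofP.
apply: qeq_trans (qeq_opVK _ _ (qclass_repr D)).
by apply: qeq_op (qeq_refl _ _); apply: qclass_repr_of.
Qed.

Lemma qclass_op_dist (A : Type) (rel : set (qterm A * qterm A))
    (C D E : qclass rel) :
  qclass_op (qclass_op C D) E = qclass_op (qclass_op C E) (qclass_op D E).
Proof.
rewrite -(qclass_reprK C) -(qclass_reprK D) -(qclass_reprK E) !qclass_opE.
apply/qclass_ofP; exact: qeq_dist.
Qed.

Definition presented_quandle (A : Type) (rel : set (qterm A * qterm A)) :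
    quandle :=
  Quandle (@qclass_op_idem A rel) (@qclass_op_bij A rel)
          (@qclass_op_dist A rel).

(** All iterated directional derivatives exist and are differentiable. *)
Definition smooth (R : realType) (V W : normedModType R) (f : V -> W) : Prop :=
  forall (vs : seq V) (x : V),
    differentiable (foldr (fun v (g : V -> W) y => 'D_v g y) f vs) x.

Definition E3 (R : realType) : normedModType R := 'rV[R]_3.

Definition sphere (R : realType) : set (E3 R) :=
  [set x | \sum_(i < 3) (x : 'rV[R]_3) ord0 i ^+ 2 = 1].

(** The area form of the sphere, oriented by its outward normal: for [u], [v]
    tangent at [x], it vanishes iff [u] and [v] are linearly dependent, and is
    positive iff [(u, v)] is a counterclockwise frame seen from outside. *)
Definition area (R : realType) (x u v : E3 R) : R :=
  \det (\matrix_(i < 3, j < 3)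
    ((nth x [:: x; u; v] i : 'rV[R]_3) ord0 j)).

(** [inl i] is the [i]-th open component, parametrised by [0, 1];
    [inr j] is the [j]-th closed component, parametrised by R modulo 1. *)
Definition component (n m : nat) : Type := ('I_n + 'I_m)%type.

Definition param (R : realType) (n m : nat) : Type := (component n m * R)%type.

Definition dom (R : realType) (n m : nat) : set (param R n m) :=
  [set p | if p.1 is inl _ then 0 <= p.2 <= 1 else True].

Definition same_param (R : realType) (n m : nat) (p q : param R n m) : Prop :=
  p.1 = q.1 /\
  if p.1 is inl _ then p.2 = q.2 else exists k : int, q.2 = p.2 + k%:~R.

Definition at_param (R : realType) (n m : nat) (g : component n m -> R -> E3 R)
  (p : param R n m) : E3 R := g p.1 p.2.

Definition velocity (R : realType) (n m : nat) (g : component n m -> R -> E3 R)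
  (p : param R n m) : E3 R := derive1 (g p.1) p.2.

(** [p] and [q] are the two preimages of a double point. *)
Definition double_pair (R : realType) (n m : nat)
    (g : component n m -> R -> E3 R) (p q : param R n m) : Prop :=
  [/\ dom p, dom q, ~ same_param p q & at_param g p = at_param g q].

(** [n] open and [m] closed components.  The values of [curve (inl i)] outside
    [0, 1] carry no information.  [underpass] is the set of passages under a
    crossing. *)
Record diagram (R : realType) (n m : nat) : Type := Diagram {
  curve : component n m -> R -> E3 R;
  underpass : set (param R n m);
  curve_smooth : forall c, smooth (curve c);
  curve_closed : forall j t, curve (inr j) (t + 1) = curve (inr j) t;
  curve_sphere : forall p : param R n m, dom p -> sphere (at_param curve p);
  curve_immersion :
    forall p : param R n m, dom p -> velocity curve p != 0;
  double_finite : finite_set [set x | exists p q : param R n m,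
    double_pair curve p q /\ at_param curve p = x];
  double_simple : forall p q r : param R n m,
    double_pair curve p q -> double_pair curve p r -> same_param q r;
  double_interior : forall p q : param R n m, double_pair curve p q ->
    if p.1 is inl _ then 0 < p.2 < 1 else true;
  double_transverse : forall p q : param R n m, double_pair curve p q ->
    area (at_param curve p) (velocity curve p) (velocity curve q) != 0;
  under_double : forall p, underpass p -> exists q, double_pair curve p q;
  under_over : forall p q, double_pair curve p q ->
    (underpass p <-> ~ underpass q) }.

(** [p] is the under-passage and [q] the over-passage of a crossing. *)
Definition crossing (R : realType) (n m : nat) (L : diagram R n m)
    (p q : param R n m) : Prop :=
  double_pair (curve L) p q /\ underpass L p.

(** The right-hand rule: the sign is +1 iff the frame
    (over-strand, under-strand) is counterclockwise. *)
Definition positive_crossing (R : realType) (n m : nat) (L : diagram R n m)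
    (p q : param R n m) : bool :=
  0 < area (at_param (curve L) p)
           (velocity (curve L) q) (velocity (curve L) p).

Definition stretch (R : realType) (n m : nat) (c : component n m) (T : set R) :
    set (param R n m) :=
  [set q | exists2 t, T t & same_param (c, t) q].

Definition free_piece (R : realType) (n m : nat) (L : diagram R n m)
    (A : set (param R n m)) : Prop :=
  exists (c : component n m) (T : set R),
    [/\ is_interval T, T !=set0, (forall t, T t -> dom (c, t)),
        (forall t, T t -> ~ underpass L (c, t)) & A = stretch c T].

Definition is_arc (R : realType) (n m : nat) (L : diagram R n m)
    (A : set (param R n m)) : Prop :=
  free_piece L A /\ forall B, free_piece L B -> A `<=` B -> B = A.

Definition arc (R : realType) (n m : nat) (L : diagram R n m) : Type :=
  {A : set (param R n m) | is_arc L A}.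

Definition incoming (R : realType) (n m : nat) (L : diagram R n m)
    (x : arc L) (p : param R n m) : Prop :=
  \forall e \near 0^'+, sval x (p.1, p.2 - e).

Definition outgoing (R : realType) (n m : nat) (L : diagram R n m)
    (z : arc L) (p : param R n m) : Prop :=
  \forall e \near 0^'+, sval z (p.1, p.2 + e).

Definition crossing_relations (R : realType) (n m : nat) (L : diagram R n m) :
    set (qterm (arc L) * qterm (arc L)) :=
  [set r | exists (p q : param R n m) (x y z : arc L),
    [/\ crossing L p q, incoming x p, sval y q, outgoing z p &
        r = (QGen z, if positive_crossing L p q
                     then QOp (QGen x) (QGen y)
                     else QOpV (QGen x) (QGen y))]].

Definition fundamental_quandle (R : realType) (n m : nat) (L : diagram R n m) :
    quandle :=
  presented_quandle (@crossing_relations R n m L).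

(** [F] and [G] need only be meaningful on [0, 1] times the sphere, where they
    are mutually inverse at each time. *)
Definition diffeotopy (R : realType) (F : R * E3 R -> E3 R) : Prop :=
  smooth F /\
  (forall x, sphere x -> F (0, x) = x) /\
  (exists G : R * E3 R -> E3 R, smooth G /\
    forall s x, 0 <= s <= 1 -> sphere x ->
      [/\ sphere (F (s, x)), sphere (G (s, x)),
          G (s, F (s, x)) = x & F (s, G (s, x)) = x]).

Definition reparametrisation (R : realType) (n m : nat)
    (rho : component n m -> R -> R) : Prop :=
  [/\ (forall c, smooth (rho c)),
      (forall c t, 0 < derive1 (rho c) t),
      (forall i, rho (inl i) 0 = 0 /\ rho (inl i) 1 = 1) &
      forall j t, rho (inr j) (t + 1) = rho (inr j) t + 1].

Definition isotopic (R : realType) (n m : nat) (L L' : diagram R n m) : Prop :=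
  exists (F : R * E3 R -> E3 R) (rho : component n m -> R -> R),
    [/\ diffeotopy F, reparametrisation rho &
        forall p : param R n m, dom p ->
          at_param (curve L') (p.1, rho p.1 p.2)
            = F (1, at_param (curve L) p) /\
          (underpass L' (p.1, rho p.1 p.2) <-> underpass L p)].

(** A closed disc in the sphere is given as the image of the closed unit disc
    of R^2 under an embedding. *)
Definition unit_disc (R : realType) : set (R * R) :=
  [set z | z.1 ^+ 2 + z.2 ^+ 2 <= 1].

Definition unit_circle (R : realType) : set (R * R) :=
  [set z | z.1 ^+ 2 + z.2 ^+ 2 = 1].

Definition disc_embedding (R : realType) (h : R * R -> E3 R) : Prop :=
  [/\ {within @unit_disc R, continuous h}, set_inj (@unit_disc R) h &
      h @` @unit_disc R `<=` @sphere R].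

(** The end piece of an open component cut off at [a], containing
    the head if [e] and the leg otherwise. *)
Definition end_interval (R : realType) (e : bool) (a : R) : set R :=
  if e then [set t | a <= t <= 1] else [set t | 0 <= t <= a].

(** [L] meets the disc exactly in the end piece [stretch (inl i) T], entering
    it at [a], and in the proper strand of [j] between [b] and [c]. *)
Definition meets_disc (R : realType) (n m : nat) (L : diagram R n m)
    (h : R * R -> E3 R) (i : 'I_n) (T : set R) (a : R)
    (j : component n m) (b c : R) : Prop :=
  [set p : param R n m | dom p /\
      (h @` @unit_disc R) (at_param (curve L) p)]
    = stretch (inl i) T `|` stretch j [set t | b <= t <= c] /\
  [set p : param R n m | dom p /\
      (h @` @unit_circle R) (at_param (curve L) p)]
    = stretch (inl i) [set a] `|` stretch j [set b; c].

(** [L'] arises from [L] by pulling an endpoint under an adjacent strand: the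
    diagrams coincide except for an end piece, which lies in a disc containing
    besides it a single strand; in [L] there is no crossing in the disc, in
    [L'] there is exactly one, where the end piece passes under the strand. *)
Definition under_pull (R : realType) (n m : nat) (L L' : diagram R n m) :
    Prop :=
  exists (i : 'I_n) (e : bool) (a : R) (j : component n m) (b c : R)
         (h : R * R -> E3 R),
    let T := end_interval e a in
    let I : set (param R n m) := stretch (inl i) T in
    let J : set (param R n m) := stretch j [set t | b <= t <= c] in
    [/\ 0 < a < 1,
        b < c /\ (if j is inl _ then 0 < b /\ c < 1 else c < b + 1),
        I `&` J = set0,
        disc_embedding h
      & [/\ meets_disc L h i T a j b c,
            meets_disc L' h i T a j b c,
            (forall p, dom p -> ~ I p ->
               at_param (curve L') p = at_param (curve L) p /\
               (underpass L' p <-> underpass L p)),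
            (forall p q, double_pair (curve L) p q -> ~ (I `|` J) p)
          & exists p q : param R n m,
              [/\ I p, J q, crossing L' p q
                & forall p' q', double_pair (curve L') p' q' ->
                    (I `|` J) p' -> same_param p' p \/ same_param p' q]]].

(** The move in either direction, between diagrams taken up to isotopy. *)
Definition under_forbidden_move (R : realType) (n m : nat)
    (L L' : diagram R n m) : Prop :=
  exists K K' : diagram R n m,
    [/\ isotopic L K, isotopic L' K' & under_pull K K' \/ under_pull K' K].

(* Main.v *)
From mathcomp Require Import all_boot all_order all_algebra.
From mathcomp Require Import all_classical all_reals all_analysis.
From mathcomp Require Import ring lra.
Require Import Defs.

(** The fundamental quandle only sees three things of a diagram: its arcs, which
    arcs meet at each crossing, and the signs of the crossings.  The move and
    the isotopies around it are therefore treated separately.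

    An isotopy followed by a reparametrisation carries passages to passages and
    arcs to arcs because it acts bijectively on parameters and monotonically
    along each component.  The one analytic point is that it preserves signs:
    along the diffeotopy [F] the frame of the two strands at a crossing stays a
    frame of the tangent plane ([diffeotopy_area_neq0]: the inverse diffeotopy
    recovers the original velocities, so the images cannot become dependent),
    hence the area it spans is a continuous function of time without zeros on
    [[0, 1]] and keeps its sign ([diffeotopy_sign]).  This gives
    [isotopic_iso].

    Pulling an endpoint under a strand cuts one arc [x] of the diagram at a new
    under-passage [p], into a stem, which keeps all the old incidences of [x],
    and a tip between [p] and the endpoint.  The tip is incident to no other
    crossing: it passes over nothing and its other end is the endpoint.  So the
    new presentation has one new generator, the tip, and one new relation, which
    expresses the tip through the stem and the over-arc (for a head directly,
    for a leg after inverting the operation).  This is a Tietze move, and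
    [end_crossing_iso] checks that the two substitutions are inverse modulo the
    relations, by the criterion [presented_quandle_iso].

    Arcs are handled through the relation [linked]: two parameters are linked
    if some segment of the component joins them without an under-passage.  The
    arcs are exactly its classes, so two arcs with a common point are equal
    ([arc_eq]).  That an arc really arrives at and leaves from each crossing
    needs crossings to be isolated along a strand ([crossing_isolated]), which
    follows from the immersion condition and the finiteness of the set of double
    points. *)

Set Implicit Arguments.
Unset Strict Implicit.
Unset Printing Implicit Defensive.
Import Order.TTheory GRing.Theory Num.Theory.
Import numFieldNormedType.Exports.
Local Open Scope classical_set_scope.
Local Open Scope ring_scope.

(** * Quandles and presentations *)

Lemma quandle_isomorphic_sym (X Y : quandle) :
  quandle_isomorphic X Y -> quandle_isomorphic Y X.
Proof.
move=> [f [[g fK gK] fM]]; exists g; split; first by exists f.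
by move=> x y; apply: (can_inj fK); rewrite fM !gK.
Qed.

Lemma quandle_isomorphic_trans (X Y Z : quandle) :
  quandle_isomorphic X Y -> quandle_isomorphic Y Z -> quandle_isomorphic X Z.
Proof.
move=> [f [fB fM]] [g [gB gM]]; exists (g \o f); split; first exact: bij_comp.
by move=> x y /=; rewrite fM gM.
Qed.

Fixpoint qsubst (A B : Type) (f : A -> qterm B) (t : qterm A) : qterm B :=
  match t with
  | QGen a => f a
  | QOp s t => QOp (qsubst f s) (qsubst f t)
  | QOpV s t => QOpV (qsubst f s) (qsubst f t)
  end.

Definition respects (A B : Type) (relA : set (qterm A * qterm A))
    (relB : set (qterm B * qterm B)) (f : A -> qterm B) : Prop :=
  forall s t, relA (s, t) -> qeq relB (qsubst f s) (qsubst f t).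

Lemma qsubst_qeq (A B : Type) (relA : set (qterm A * qterm A))
    (relB : set (qterm B * qterm B)) (f : A -> qterm B) (s t : qterm A) :
  respects relA relB f -> qeq relA s t -> qeq relB (qsubst f s) (qsubst f t).
Proof.
move=> rf; elim=> {s t} /=; [exact: rf | move=> *; exact: qeq_refl
  | move=> s t _; exact: qeq_sym | move=> s t u _ st _; exact: qeq_trans st
  | move=> s s' t t' _ ss _; exact: qeq_op | move=> s s' t t' _ ss _;
  exact: qeq_opV | move=> *; exact: qeq_idem | move=> *; exact: qeq_opK
  | move=> *; exact: qeq_opVK | move=> *; exact: qeq_dist].
Qed.

Lemma qsubstK (A B : Type) (relA : set (qterm A * qterm A))
    (f : A -> qterm B) (g : B -> qterm A) :
  (forall a, qeq relA (qsubst g (f a)) (QGen a)) ->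
  forall t, qeq relA (qsubst g (qsubst f t)) t.
Proof.
by move=> gf; elim=> [a|s hs t ht|s hs t ht] /=;
  [exact: gf | exact: qeq_op | exact: qeq_opV].
Qed.

(** Tietze's criterion: substitutions of terms for generators which respect the
    relations and undo each other on generators, up to the relations, induce
    mutually inverse morphisms. *)
Lemma presented_quandle_iso (A B : Type) (relA : set (qterm A * qterm A))
    (relB : set (qterm B * qterm B)) (f : A -> qterm B) (g : B -> qterm A) :
  respects relA relB f -> respects relB relA g ->
  (forall a, qeq relA (qsubst g (f a)) (QGen a)) ->
  (forall b, qeq relB (qsubst f (g b)) (QGen b)) ->
  quandle_isomorphic (presented_quandle relA) (presented_quandle relB).
Proof.
move=> rf rg gf fg.
exists (fun C => qclass_of relB (qsubst f (qclass_repr C))); split.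
  exists (fun C => qclass_of relA (qsubst g (qclass_repr C))) => C.
    rewrite -[RHS]qclass_reprK; apply/qclass_ofP.
    apply: qeq_trans (qsubstK gf _).
    by apply: (qsubst_qeq rg); exact: qclass_repr_of.
  rewrite -[RHS]qclass_reprK; apply/qclass_ofP.
  apply: qeq_trans (qsubstK fg _).
  by apply: (qsubst_qeq rf); exact: qclass_repr_of.
move=> C D; rewrite /= qclass_opE; apply/qclass_ofP.
by apply: (@qsubst_qeq _ _ _ _ _ _ (QOp _ _) rf); exact: qclass_repr_of.
Qed.

(** The operation with exponent +1 or -1, the form in which the sign of a
    crossing enters its relation. *)
Definition qpow (A : Type) (e : bool) (s t : qterm A) : qterm A :=
  if e then QOp s t else QOpV s t.

Lemma qsubst_qpow (A B : Type) (f : A -> qterm B) e s t :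
  qsubst f (qpow e s t) = qpow e (qsubst f s) (qsubst f t).
Proof. by case: e. Qed.

Lemma qeq_qpow (A : Type) (rel : set (qterm A * qterm A)) e s s' t :
  qeq rel s s' -> qeq rel (qpow e s t) (qpow e s' t).
Proof.
by case: e => ss; [apply: qeq_op | apply: qeq_opV] => //; exact: qeq_refl.
Qed.

Lemma qeq_qpowK (A : Type) (rel : set (qterm A * qterm A)) e s t :
  qeq rel (qpow (~~ e) (qpow e s t) t) s.
Proof. by case: e; [exact: qeq_opK | exact: qeq_opVK]. Qed.

(** * Arcs *)

Section Arcs.
Context (R : realType) (n m : nat).
Implicit Types (L : diagram R n m) (p q r : param R n m).

Lemma same_param_refl p : same_param p p.
Proof. by split=> //; case: p.1 => // _; exists 0; rewrite addr0. Qed.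

Lemma same_param_sym p q : same_param p q -> same_param q p.
Proof.
case: p q => [c s] [d t] [/= <-]; case: c => [i|j] h; split=> //=.
by case: h => k ->; exists (- k); rewrite rmorphN addrK.
Qed.

Lemma same_param_trans p q r :
  same_param p q -> same_param q r -> same_param p r.
Proof.
case: p q r => [c s] [d t] [e u] [/= <-] + [/= <-]; case: c => [i|j].
  by move=> -> ->.
by move=> [k ->] [l ->]; split=> //=; exists (k + l); rewrite rmorphD addrA.
Qed.

Lemma same_param_dom p q : same_param p q -> dom p -> dom q.
Proof.
by case: p q => [c s] [d t] [/= <-]; case: c => // i /= ->.
Qed.

Lemma same_param_open (i : 'I_n) (t : R) q :
  same_param (inl i, t) q -> q = (inl i, t).
Proof. by case: q => d s [/= <- ->]. Qed.

(** Closed components are parametrised by R modulo 1, so everything attached to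
    a passage has to be checked to be independent of the representative. *)
Lemma curve_period L j (k : int) (t : R) :
  curve L (inr j) (t + k%:~R) = curve L (inr j) t.
Proof.
have nat_period (k0 : nat) s : curve L (inr j) (s + k0%:R) = curve L (inr j) s.
  elim: k0 s => [|k0 IH] s; first by rewrite addr0.
  by rewrite -natr1 addrA curve_closed IH.
case: k => k0; first exact: nat_period.
by rewrite -[in RHS](subrK k0.+1%:R t) nat_period NegzE rmorphN.
Qed.

Lemma same_param_at L p q :
  same_param p q -> at_param (curve L) p = at_param (curve L) q.
Proof.
case: p q => [c s] [d t] [/= <-]; case: c => [i ->//|j [k ->]].
by rewrite /at_param /= curve_period.
Qed.

Lemma same_param_velocity L p q :
  same_param p q -> velocity (curve L) p = velocity (curve L) q.
Proof.
case: p q => [c s] [d t] [/= <-]; case: c => [i|j] /= h; first by rewrite h.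
case: h => k ->.
rewrite /velocity /= /derive1 curve_period.
set u := fun _ => _; set v := fun _ => _; suff -> : u = v by [].
by apply/funext => h; rewrite /u /v addrA curve_period.
Qed.

Lemma double_pair_sym L p q :
  double_pair (curve L) p q -> double_pair (curve L) q p.
Proof.
by move=> [dp dq npq e]; split=> // qp; apply/npq/same_param_sym.
Qed.

Lemma same_param_double L p q r :
  same_param p r -> double_pair (curve L) p q -> double_pair (curve L) r q.
Proof.
move=> pr [dp dq npq e]; split; rewrite -?(same_param_at L pr)//.
  exact: same_param_dom dp.
by move=> rq; apply: npq; exact: same_param_trans rq.
Qed.

Lemma same_param_underpass L p q :
  same_param p q -> underpass L p -> underpass L q.
Proof.
move=> pq up; have [r pr] := under_double up.
by apply/(under_over (same_param_double pq pr)); apply/(under_over pr).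
Qed.

Definition free_param L p : Prop := dom p /\ ~ underpass L p.

Lemma same_param_free L p q :
  same_param p q -> free_param L p -> free_param L q.
Proof.
move=> pq [dp up]; split; first exact: same_param_dom dp.
by move=> uq; apply: up; exact: same_param_underpass (same_param_sym pq) uq.
Qed.

Definition between (s t u : R) : bool := (s <= u <= t) || (t <= u <= s).

(** [same_param] lets the segment that starts at [p] end at any representative
    of [q], so that on a closed component it may run past the base point. *)
Definition linked L p q : Prop :=
  exists2 t, same_param (p.1, t) q &
    forall s, between p.2 t s -> free_param L (p.1, s).

(** Both points may be given by parameters outside of the interval that cuts out
    the piece; the segment is translated there by integers. *)
Lemma free_piece_linked L A p q : free_piece L A -> A p -> A q -> linked L p q.
Proof.
move=> [c [T [Ti _ Td Tu ->]]] [s Ts sp] [t Tt tq].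
have fT u : T u -> free_param L (c, u).
  by move=> Tu'; split; [exact: Td | exact: Tu].
have btT u : between s t u -> T u.
  by move=> /orP[]; [apply: Ti Ts Tt _ | apply: Ti Tt Ts _].
case: p sp => d p2 [/= <- {d}]; case: c {Td Tu} fT tq => [i|j] fT tq.
  by move=> <-; exists t => // u /btT; exact: fT.
move=> [k ->]; exists (t + k%:~R) => /= [|u su].
  apply: same_param_trans tq; apply: same_param_sym.
  by split=> //=; exists k.
have sp : same_param ((inr j, u - k%:~R) : param R n m) (inr j, u).
  by split=> //=; exists k; rewrite subrK.
apply: same_param_free sp _; apply/fT/btT.
by move: su; rewrite /between /= !lerBlDr !lerBrDr.
Qed.

Lemma linked_refl L p : free_param L p -> linked L p p.
Proof.
move=> fp; exists p.2; first by case: p {fp} => c t; exact: same_param_refl.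
move=> s; rewrite /between orbb => /le_anti <-.
by case: p fp.
Qed.

Lemma linked_free_piece L p : free_param L p -> free_piece L (linked L p).
Proof.
move=> fp; pose T t := forall s, between p.2 t s -> free_param L (p.1, s).
have Tt t : T t -> free_param L (p.1, t).
  by apply; rewrite /between lexx andbT; exact: le_total.
exists p.1, T; split.
- move=> s t Ts Tt' u /andP[su ut] v /orP[|] /andP[h1 h2].
    by apply: Tt'; rewrite /between h1 (le_trans h2).
  by apply: Ts; rewrite /between h2 (le_trans su) ?orbT.
- exists p.2 => s; rewrite /between orbb => /le_anti <-.
  by case: p fp {T Tt}.
- by move=> t /Tt[].
- by move=> t /Tt[].
- by apply/seteqP; split=> q [t h1 h2]; exists t.
Qed.

(** Maximality is automatic: a free piece around [p] consists of points linked
    to [p]. *)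
Lemma linked_is_arc L p : free_param L p -> is_arc L (linked L p).
Proof.
move=> fp; split=> [|B fB AB]; first exact: linked_free_piece.
apply/seteqP; split=> // q Bq.
by apply: free_piece_linked fB _ Bq; apply: AB; exact: linked_refl.
Qed.

Lemma free_piece_free L A p : free_piece L A -> A p -> free_param L p.
Proof.
move=> [c [T [_ _ Td Tu ->]]] [t Tt tp].
by apply: same_param_free tp _; split; [exact: Td | exact: Tu].
Qed.

Lemma arc_free L (x : arc L) p : sval x p -> free_param L p.
Proof. by case: x => A [/= fA _]; exact: free_piece_free. Qed.

Lemma arc_linkedE L (x : arc L) p : sval x p -> sval x = linked L p.
Proof.
move=> xp; have fp := arc_free xp; case: x xp => A [fA maxA] /= Ap.
symmetry; apply: maxA; first exact: linked_free_piece.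
by move=> q; exact: free_piece_linked.
Qed.

Lemma arc_eq L (x y : arc L) p : sval x p -> sval y p -> x = y.
Proof.
move=> xp yp.
have : sval x = sval y by rewrite (arc_linkedE xp) (arc_linkedE yp).
by case: x y {xp yp} => [A hA] [B hB] /=; exact: eq_exist.
Qed.

Lemma arc_same_param L (x : arc L) p q :
  same_param p q -> sval x p -> sval x q.
Proof.
have [[c [T [_ _ _ _ ->]]] _] := proj2_sig x => pq [t Tt tp].
by exists t => //; exact: same_param_trans pq.
Qed.

Lemma arc_inhabited L (x : arc L) : exists p, sval x p.
Proof.
have [[c [T [_ [t Tt] _ _ ->]]] _] := proj2_sig x.
by exists (c, t); exists t => //; exact: same_param_refl.
Qed.

Lemma arc_through L p : free_param L p -> exists x : arc L, sval x = linked L p.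
Proof. by move=> fp; exists (exist _ _ (linked_is_arc fp)). Qed.

End Arcs.

(** * Signs of crossings under a diffeotopy *)

Section Area.
Context (R : realType).
Implicit Types (x u v w : E3 R) (gamma delta : R -> E3 R).

Lemma smooth_differentiable (V W : normedModType R) (f : V -> W) (x : V) :
  smooth f -> differentiable f x.
Proof. by move=> /(_ [::] x). Qed.

Lemma smooth_continuous (V W : normedModType R) (f : V -> W) :
  smooth f -> continuous f.
Proof.
by move=> sf x; exact/differentiable_continuous/smooth_differentiable.
Qed.

Lemma smooth_derive (V W : normedModType R) (f : V -> W) (v : V) :
  smooth f -> continuous (fun y => 'D_v f y).
Proof. by move=> sf x; exact/differentiable_continuous/(sf [:: v]). Qed.

Lemma derive1_slice (V W : normedModType R) (H : R * V -> W) (g : R -> V)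
    (s t : R) :
  differentiable H (s, g t) -> differentiable g t ->
  derive1 (fun t => H (s, g t)) t = 'D_(0, derive1 g t) H (s, g t).
Proof.
move=> dH dg; have dp : differentiable (fun t => (s, g t)) t.
  exact: differentiable_pair.
have -> : (fun t => H (s, g t)) = H \o (fun t => (s, g t)) by [].
rewrite derive1E' ?deriveE //; last exact: differentiable_comp.
by rewrite diff_comp //= diff_pair //= diff_cst derive1E'.
Qed.

Definition det3 (x u v : E3 R) : R :=
  let c (w : E3 R) (k : 'I_3) := (w : 'rV[R]_3) ord0 k in
  let i : 'I_3 := ord0 in let j : 'I_3 := lift ord0 ord0 in
  let k : 'I_3 := ord_max in
    c x i * (c u j * c v k - c u k * c v j)
  - c x j * (c u i * c v k - c u k * c v i)
  + c x k * (c u i * c v j - c u j * c v i).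

(** Only this polynomial form is used for continuity and scaling. *)
Lemma areaE x u v : area x u v = det3 x u v.
Proof.
rewrite /area (expand_det_row _ ord0) !big_ord_recl big_ord0 /cofactor.
rewrite !(expand_det_row _ ord0) !big_ord_recl !big_ord0 /cofactor !det_mx11.
rewrite !mxE /= /det3.
(* Computing the indices as numbers identifies the different ordinal terms
   that the expansions produce for the same column. *)
have [c cE] : exists c : E3 R -> nat -> R,
    forall w (k : 'I_3), (w : 'rV[R]_3) ord0 k = c w k.
  exists (fun w k => (w : 'rV[R]_3) ord0 (inord k)) => w k.
  by rewrite inord_val.
by rewrite !cE /= /bump /= !addn0 !add0n; ring.
Qed.

Lemma cvg_area (T : Type) (F : set_system T) (FF : Filter F)
    (f g h : T -> E3 R) x u v :
  f @ F --> x -> g @ F --> u -> h @ F --> v ->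
  (fun t => area (f t) (g t) (h t)) @ F --> area x u v.
Proof.
move=> fx gu hv; under eq_fun do rewrite areaE; rewrite areaE /det3.
have crd (k : T -> E3 R) (w : E3 R) i : k @ F --> w ->
    (fun t => (k t : 'rV[R]_3) ord0 i) @ F --> (w : 'rV[R]_3) ord0 i.
  move=> kw; have ci := @coord_continuous R 1 3 ord0 i w.
  exact: cvg_comp kw ci.
by apply: cvgD; [apply: cvgB|]; apply: cvgM; (try apply: cvgB; try apply: cvgM);
  exact: crd.
Qed.

Lemma areaZ (a b : R) x u v : area x (a *: u) (b *: v) = a * b * area x u v.
Proof. by rewrite !areaE /det3 !mxE; ring. Qed.

Definition dot x y : R :=
  \sum_(i < 3) (x : 'rV[R]_3) ord0 i * (y : 'rV[R]_3) ord0 i.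

(** A vanishing determinant gives a dependency of [x], [u], [v]; taking the dot
    product with the unit vector [x] shows that [x] does not occur in it. *)
Lemma area_eq0 x u v : sphere x -> dot x u = 0 -> dot x v = 0 ->
  area x u v = 0 -> exists b c, (b, c) != (0, 0) /\ b *: u + c *: v = 0.
Proof.
move=> sx xu xv /eqP/det0P[w w0 wM].
pose w' (k : nat) := (w : 'rV[R]_3) ord0 (inord k).
have wE : w' 0%N *: x + w' 1%N *: u + w' 2%N *: v = 0.
  apply/rowP => k; move/rowP/(_ k): wM.
  rewrite !mxE !big_ord_recl big_ord0 !mxE.
  move=> <-; rewrite addr0 addrA /w'; congr (_ * _ + _ * _ + _ * _);
    by congr (w _ _); apply/val_inj; rewrite /= inordK.
have w0' : w' 0%N = 0.
  have : dot x (w' 0%N *: x + w' 1%N *: u + w' 2%N *: v) = 0.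
    by rewrite wE /dot big1 // => k _; rewrite mxE mulr0.
  have -> : dot x (w' 0%N *: x + w' 1%N *: u + w' 2%N *: v) =
      w' 0%N * \sum_(i < 3) (x : 'rV[R]_3) ord0 i ^+ 2 +
      w' 1%N * dot x u + w' 2%N * dot x v.
    rewrite /dot !mulr_sumr -!big_split /=; apply: eq_bigr => k _.
    by rewrite !mxE; ring.
  by rewrite sx xu xv !mulr0 !addr0 mulr1.
exists (w' 1%N), (w' 2%N); split; last by rewrite -wE w0' scale0r add0r.
apply: contra_neq w0 => -[w1 w2]; apply/rowP => k; rewrite mxE.
have -> : w ord0 k = w' k by rewrite /w' inord_val.
by case: k => [[|[|[|//]]] /= _].
Qed.

Lemma area_neq0 x u v (b c : R) : area x u v != 0 ->
  b *: u + c *: v = 0 -> (b, c) = (0, 0).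
Proof.
move=> + uv; apply: contra_neq_eq => bc; apply/eqP/det0P.
pose w := \row_(k < 3) [:: 0; b; c]`_k.
exists w; last first.
  apply/rowP => k; move/rowP/(_ k): uv.
  rewrite !mxE !big_ord_recl big_ord0 !mxE /=.
  by rewrite mul0r add0r addr0.
apply: contra_neq bc => /rowP w0.
by have := w0 (lift ord0 ord0); have := w0 ord_max; rewrite !mxE /= => -> ->.
Qed.

(** Differentiating the equation of the sphere along the curve. *)
Lemma tangent (g : R -> E3 R) (t : R) :
  (\forall s \near t, sphere (g s)) -> differentiable g t ->
  dot (g t) (derive1 g t) = 0.
Proof.
move=> sg dg.
have dg1 : derivable (g : R -> 'rV[R]_3) t 1 by exact/derivable1_diffP.
have dgi i : derivable (fun s => (g s : 'rV[R]_3) ord0 i) t 1.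
  by move/derivable_mxP : dg1.
have e : 'D_1 (fun s => \sum_(i < 3) (g s : 'rV[R]_3) ord0 i ^+ 2) t = 0.
  transitivity ('D_1 (cst 1 : R -> R) t); last exact: derive_cst.
  exact: near_eq_derive.
move: e; rewrite (_ : (fun s => _) =
    \sum_(i < 3) (fun s => (g s : 'rV[R]_3) ord0 i) ^+ 2); last first.
  by apply/funext => s; rewrite fct_sumE.
rewrite derive_sum => [|i]; last exact: derivableX.
under eq_bigr do rewrite deriveX //= expr1.
move=> e.
have : 2 * dot (g t) (derive1 g t) = 0; last first.
  by move/eqP; rewrite mulf_eq0 pnatr_eq0 => /eqP.
rewrite -e /dot mulr_sumr; apply: eq_bigr => i _.
by rewrite derive1E (derive_mx dg1) mxE mulrA.
Qed.

End Area.

Section Transport.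
Context (R : realType).

Lemma same_sign_on_unit_interval (a : R -> R) : continuous a ->
  (forall s, 0 <= s <= 1 -> a s != 0) -> (0 < a 1) = (0 < a 0).
Proof.
move=> ca an0.
have no_change : ~~ (Num.min (a 0) (a 1) <= 0 <= Num.max (a 0) (a 1)).
  apply/negP => h; have [c c01 ac0] := IVT ler01 (continuous_subspaceT ca) h.
  by move: c01; rewrite in_itv /= => /an0; rewrite ac0 eqxx.
have n0 : a 0 != 0 by rewrite an0 ?lexx ?ler01.
have n1 : a 1 != 0 by rewrite an0 ?lexx ?ler01.
move: no_change; rewrite ge_min le_max.
by case: (ltgtP (a 0) 0) n0 => //; case: (ltgtP (a 1) 0) n1.
Qed.

(** If the transported velocities were dependent, the differential of the
    inverse diffeotopy, which sends them back to the original velocities, would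
    make those dependent too.  The diffeotopy is only invertible on the sphere,
    so the chain rule is applied along the two strands instead of in all
    directions. *)
Lemma diffeotopy_area_neq0 (F : R * E3 R -> E3 R) (g h : R -> E3 R)
    (t u s : R) :
  diffeotopy F -> 0 <= s <= 1 -> g t = h u ->
  (\forall t \near t, sphere (g t)) -> (\forall u \near u, sphere (h u)) ->
  differentiable g t -> differentiable h u ->
  area (g t) (derive1 g t) (derive1 h u) != 0 ->
  area (F (s, g t)) (derive1 (fun t => F (s, g t)) t)
    (derive1 (fun u => F (s, h u)) u) != 0.
Proof.
move=> [sF [F0 [G [sG FG]]]] s01 gh sg sh dg dh gh0; apply/negP => /eqP a0.
have dFs (k : R -> E3 R) v : differentiable k v ->
    differentiable (fun v => F (s, k v)) v.
  move=> dk; apply: (@differentiable_comp _ _ _ _ (fun v => (s, k v)) F).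
    exact: differentiable_pair.
  exact: smooth_differentiable.
have tan (k : R -> E3 R) v : (\forall v \near v, sphere (k v)) ->
    differentiable k v ->
    dot (F (s, k v)) (derive1 (fun v => F (s, k v)) v) = 0.
  move=> sk dk; apply: (@tangent _ (fun v => F (s, k v))); last exact: dFs.
  by apply: filterS sk => w sw; have [] := FG s (k w) s01 sw.
have inv (k : R -> E3 R) v : (\forall v \near v, sphere (k v)) ->
    differentiable k v ->
    'D_(0, derive1 (fun v => F (s, k v)) v) G (s, F (s, k v)) = derive1 k v.
  move=> sk dk; rewrite -(@derive1_slice _ _ _ G (fun v => F (s, k v))).
  - rewrite !derive1E; apply: near_eq_derive.
    by apply: filterS sk => w sw; have [] := FG s (k w) s01 sw.
  - exact: smooth_differentiable.
  - exact: dFs.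
have := area_eq0 _ (tan _ _ sg dg) _ a0; rewrite {2}gh.
case; [by have [] := FG s (g t) s01 (nbhs_singleton sg) | exact: tan |].
move=> b [c [bc]].
set p := derive1 _ t; set q := derive1 _ u => e.
have : 'd G (s, F (s, g t)) (0, b *: p + c *: q) = 0.
  by rewrite e linear0.
rewrite (_ : (0, _) = b *: ((0, p) : R * E3 R) + c *: ((0, q) : R * E3 R)).
  rewrite linearP linearZ /= -!deriveE; try exact: smooth_differentiable.
  rewrite (inv _ _ sg dg) gh (inv _ _ sh dh) => /(area_neq0 gh0) bc0.
  by rewrite bc0 eqxx in bc.
by congr pair; rewrite /= !scaler0 addr0.
Qed.

(** At time 0 the area is that of the original frame, and it never vanishes on
    the way to time 1. *)
Lemma diffeotopy_sign (F : R * E3 R -> E3 R) (g h : R -> E3 R) (t u : R) :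
  diffeotopy F -> g t = h u ->
  (\forall t \near t, sphere (g t)) -> (\forall u \near u, sphere (h u)) ->
  differentiable g t -> differentiable h u ->
  area (g t) (derive1 g t) (derive1 h u) != 0 ->
  (0 < area (F (1, g t)) (derive1 (fun t => F (1, g t)) t)
    (derive1 (fun u => F (1, h u)) u)) =
  (0 < area (g t) (derive1 g t) (derive1 h u)).
Proof.
move=> dF gh sg sh dg dh gh0; have [sF [F0 _]] := dF.
pose a s := area (F (s, g t)) ('D_(0, derive1 g t) F (s, g t))
  ('D_(0, derive1 h u) F (s, g t)).
have aE s : a s = area (F (s, g t)) (derive1 (fun t => F (s, g t)) t)
    (derive1 (fun u => F (s, h u)) u).
  have dFs x : differentiable F (s, x) by exact: smooth_differentiable.
  by rewrite (derive1_slice (dFs _) dg) (derive1_slice (dFs _) dh) -gh.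
have d0 (k : R -> E3 R) v : (\forall v \near v, sphere (k v)) ->
    derive1 (fun v => F (0, k v)) v = derive1 k v.
  move=> sk; rewrite !derive1E; apply: near_eq_derive.
  by apply: filterS sk => w; exact: F0.
have a0 : a 0 = area (g t) (derive1 g t) (derive1 h u).
  by rewrite aE !d0 // F0 //; exact: nbhs_singleton sg.
rewrite -aE -a0; apply: same_sign_on_unit_interval => [s|s s01]; last first.
  by rewrite aE; exact: diffeotopy_area_neq0.
have cs : (fun r => (r, g t)) @ s --> (s, g t).
  have dp : differentiable (fun r : R => (r, g t)) s.
    exact: differentiable_pair.
  exact: differentiable_continuous dp.
have cD v : (fun r => 'D_(0, v) F (r, g t)) @ s --> 'D_(0, v) F (s, g t).
  have dF' := @smooth_derive _ _ _ F (0, v) sF (s, g t).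
  exact: cvg_comp cs dF'.
have cF : (fun r => F (r, g t)) @ s --> F (s, g t).
  have cF := differentiable_continuous (smooth_differentiable (s, g t) sF).
  exact: cvg_comp cs cF.
exact: cvg_area.
Qed.

End Transport.

(** * Isotopic diagrams *)

Section Increasing.
Context (R : realType).
Implicit Types (f : R -> R) (P : set R).

Lemma increasing_onto_between f (a b y : R) : continuous f ->
  {homo f : s t / s < t} -> f a <= y <= f b -> exists2 c, a <= c <= b & f c = y.
Proof.
move=> cf hf /andP[ay yb].
have ab : a <= b.
  by rewrite leNgt; apply/negP => /hf; rewrite ltNge (le_trans ay).
have [|c] := IVT ab (continuous_subspaceT cf) (v := y).
  by rewrite ge_min le_max ay yb orbT.
by rewrite in_itv /= => cab <-; exists c.
Qed.

(** Being incoming is a condition on the points just before a passage, so it is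
    carried along by an increasing homeomorphism although the distances to the
    passage change. *)
Lemma increasing_near_left f P t : continuous f -> {homo f : s t / s < t} ->
  (\forall e \near 0^'+, P (f t - e)) <-> (\forall e \near 0^'+, P (f (t - e))).
Proof.
move=> cf hf; split.
  move=> /nbhs_left0P; rewrite near_withinE => nP.
  apply/(nbhs_left0P t (fun s => P (f s))); rewrite near_withinE.
  have /= nPf := cf t _ nP.
  by near=> s => /hf; near: s.
move=> /(nbhs_left0P t (fun s => P (f s))).
rewrite near_withinE => /nbhs_ballP[d /= d0 dP].
have td : t - d < t by rewrite ltrBlDr ltrDl.
apply/nbhs_left0P; near=> y.
have yt : y < f t by near: y; exact: nbhs_left_lt.
have dy : f (t - d) < y by near: y; apply: nbhs_left_gt; exact: hf.
have [|s /andP[ds st] fs] := @increasing_onto_between f (t - d) t y cf hf.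
  by rewrite !ltW.
have lt_of u v : f u < f v -> u <= v -> u < v.
  move=> fuv; rewrite le_eqVlt => /predU1P[uv|//].
  by move: fuv; rewrite uv ltxx.
have {}st : s < t by apply: lt_of st; rewrite fs.
have {}ds : t - d < s by apply: lt_of ds; rewrite fs.
rewrite -fs; apply: dP => //; rewrite /ball /= gtr0_norm ?subr_gt0 //.
by rewrite ltrBlDr -ltrBlDl.
Unshelve. all: by end_near. Qed.

Lemma increasing_near_right f P t : continuous f -> {homo f : s t / s < t} ->
  (\forall e \near 0^'+, P (f t + e)) <-> (\forall e \near 0^'+, P (f (t + e))).
Proof.
move=> cf hf; pose f' s := - f (- s).
have e1 e : - (f' (- t) - e) = f t + e by rewrite /f' opprB !opprK addrC.
have e2 e : - f' (- t - e) = f (t + e) by rewrite /f' opprK opprB opprK addrC.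
have cf' : continuous f'.
  move=> s; apply: cvgN.
  apply: (@cvg_comp _ _ _ (@GRing.opp R) f); last exact: cf.
  exact: oppr_continuous.
have hf' : {homo f' : s t / s < t} by move=> s u su; rewrite ltrN2 hf // ltrN2.
have [l r] := @increasing_near_left f' (fun y => P (- y)) (- t) cf' hf'.
split=> h.
  have /l : \forall e \near 0^'+, P (- (f' (- t) - e)).
    by apply: filterS h => e; rewrite e1.
  by apply: filterS => e; rewrite e2.
have /r : \forall e \near 0^'+, P (- f' (- t - e)).
  by apply: filterS h => e; rewrite e2.
by apply: filterS => e; rewrite e1.
Qed.

End Increasing.

Section Interior.
Context (R : realType).

Lemma derive1_comp_scale (V : normedModType R) (g : R -> V) (f : R -> R)
    (t : R) :
  differentiable f t -> differentiable g (f t) ->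
  derive1 (g \o f) t = derive1 f t *: derive1 g (f t).
Proof.
move=> df dg; have e1 := derive1E' df; have e2 := derive1E' dg.
have e3 := derive1E' (differentiable_comp df dg).
apply: (etrans e3).
apply: (etrans (congr1 (fun h : R -> V => h 1) (diff_comp df dg))).
have e5 : 'd f t 1 = derive1 f t *: (1 : R) by rewrite e1 [RHS]mulr1.
apply: (etrans (congr1 ('d g (f t)) e5)).
apply: (etrans (linearZ _ _)).
exact: (congr1 (GRing.scale _) (esym e2)).
Qed.

Lemma double_near_dom (n m : nat) (L : diagram R n m) (p q : param R n m) :
  double_pair (curve L) p q -> \forall t \near p.2, dom (p.1, t).
Proof.
move=> /double_interior; case: p => [[i|j] t] /=; last by move=> _; near=> s.
move=> /andP[t0 t1]; near=> s; rewrite /dom /=; apply/andP; split; apply/ltW.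
  by near: s; exact: lt_nbhsr.
by near: s; exact: lt_nbhsl.
Unshelve. all: by end_near. Qed.

End Interior.

Section Isotopy.
Context (R : realType) (n m : nat) (L L' : diagram R n m).
Context (F : R * E3 R -> E3 R) (rho : component n m -> R -> R).
Hypothesis dF : diffeotopy F.
Hypothesis rrho : reparametrisation rho.
Hypothesis rhoP : forall p : param R n m, dom p ->
  at_param (curve L') (p.1, rho p.1 p.2) = F (1, at_param (curve L) p) /\
  (underpass L' (p.1, rho p.1 p.2) <-> underpass L p).
Implicit Types p q : param R n m.

Let push p : param R n m := (p.1, rho p.1 p.2).

Let rho_cont c : continuous (rho c).
Proof. by case: rrho => + _ _ _; move=> /(_ c) /smooth_continuous. Qed.

Let rho_homo c : {homo rho c : s t / s < t}.
Proof.
case: rrho => sm dpos _ _ s t st.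
apply: (@gtr0_derive1_lt_cc _ (rho c) s t) => //.
- by move=> x _; exact/derivable1_diffP/smooth_differentiable.
- exact/continuous_subspaceT/rho_cont.
- by rewrite in_itv /= lexx ltW.
- by rewrite in_itv /= lexx ltW.
Qed.

Let rho_le c : {mono rho c : s t / s <= t}.
Proof. exact/le_mono/rho_homo. Qed.

Let rho_inj c : injective (rho c).
Proof.
by move=> s t e; apply/le_anti; rewrite -(rho_le c) -[t <= s](rho_le c) e lexx.
Qed.

Let rho_period j (k : int) t : rho (inr j) (t + k%:~R) = rho (inr j) t + k%:~R.
Proof.
case: rrho => _ _ _ period.
have nat_period (k0 : nat) s : rho (inr j) (s + k0%:R) = rho (inr j) s + k0%:R.
  elim: k0 s => [|k0 IH] s; first by rewrite !addr0.
  by rewrite -natr1 addrA period IH addrA.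
case: k => k0; first exact: nat_period.
rewrite -[in RHS](subrK k0.+1%:R t) nat_period NegzE rmorphN.
by rewrite addrK.
Qed.

Let push_same p q : same_param (push p) (push q) <-> same_param p q.
Proof.
case: p q => [c s] [d t]; rewrite /same_param /push /=.
split=> -[<-]; case: c => [i|j].
- by move=> /rho_inj ->.
- by move=> [k]; rewrite -rho_period => /rho_inj ->; split=> //; exists k.
- by move=> ->.
- by move=> [k ->]; split=> //; exists k; rewrite rho_period.
Qed.

Let push_dom p : dom (push p) <-> dom p.
Proof.
case: p => [[i|j] t]; rewrite /dom //= .
case: rrho => _ _ /(_ i)[r0 r1] _.
suff -> : (0 <= rho (inl i) t <= 1) = (0 <= t <= 1) by [].
have := rho_le (inl i) t 1; have := rho_le (inl i) 0 t.
by rewrite r0 r1 => -> ->.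
Qed.

Let push_onto q : dom q -> exists2 p, dom p & q = push p.
Proof.
case: q => [[i|j] y]; rewrite /dom /= => dq.
  case: rrho => _ _ /(_ i)[r0 r1] _.
  have [|t t01 <-] := @increasing_onto_between _ (rho (inl i)) 0 1 y
    (@rho_cont _) (@rho_homo _); first by rewrite r0 r1.
  by exists (inl i, t).
(* [rho] moves integers by integers, so an interval of length 1 is reached. *)
have [k hk] : exists k : int, k%:~R <= y - rho (inr j) 0 <= (k + 1)%:~R.
  exists (Num.floor (y - rho (inr j) 0)).
  by rewrite ge_floor ltW // floorD1_gt.
have [|t _ <-] := @increasing_onto_between _ (rho (inr j)) k%:~R (k + 1)%:~R y
    (@rho_cont _) (@rho_homo _).
  rewrite -[X in rho _ X]add0r -[X in _ <= rho _ X]add0r !rho_period.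
  by move: hk; rewrite lerBrDl lerBlDl.
by exists (inr j, t).
Qed.

Let push_under p : dom p -> (underpass L' (push p) <-> underpass L p).
Proof. by move=> /rhoP[]. Qed.

Let push_free p : free_param L' (push p) <-> free_param L p.
Proof.
by split=> -[dp up];
  [have dp' := (push_dom p).1 dp | have dp' := (push_dom p).2 dp];
  split=> // /push_under; [move=> /(_ dp')|move=> /(_ dp)]; exact: up.
Qed.

Let push_double p q :
  double_pair (curve L') (push p) (push q) <-> double_pair (curve L) p q.
Proof.
case: dF => _ [_ [G [_ FG]]].
have h01 : 0 <= (1 : R) <= 1 by rewrite lexx ler01.
split=> -[dp dq npq e].
  move/push_dom: dp => dp; move/push_dom: dq => dq.
  split=> //; first by move/push_same.
  move: e; rewrite /push (rhoP dp).1 (rhoP dq).1 => e.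
  have [_ _ <- _] := FG 1 _ h01 (curve_sphere L dp).
  by have [_ _ <- _] := FG 1 _ h01 (curve_sphere L dq); rewrite e.
split; [exact/push_dom|exact/push_dom|by move/push_same|].
by rewrite /push (rhoP dp).1 (rhoP dq).1 e.
Qed.

Let push_crossing p q : crossing L' (push p) (push q) <-> crossing L p q.
Proof.
split=> -[pq u].
  have pq' := (push_double p q).1 pq; have [dp _ _ _] := pq'.
  by split=> //; apply/(push_under dp).
by have [dp _ _ _] := pq; split; [apply/push_double | apply/(push_under dp)].
Qed.

Let push_linked p q : linked L' (push p) (push q) <-> linked L p q.
Proof.
split.
  move=> [y yq fy].
  have [t ty] : exists t, y = rho p.1 t.
    have yy : between (push p).2 y y by rewrite /between lexx andbT le_total.
    have [+ _] := fy y yy.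
    by move=> /push_onto[[c t] _ [/= -> ->]]; exists t.
  exists t; first by apply/push_same; rewrite /push /= -ty.
  move=> s st; apply/(push_free (p.1, s)); apply: fy.
  by rewrite ty /between /push /= !rho_le.
move=> [t tq ft]; exists (rho p.1 t); first by apply/(push_same (p.1, t)).
move=> y yt.
have [s st <-] : exists2 s, between p.2 t s & rho p.1 s = y.
  by case/orP: yt => /increasing_onto_between;
    move=> /(_ (@rho_cont _) (@rho_homo _))[s st e]; exists s;
    rewrite // /between st ?orbT.
by apply/(push_free (p.1, s)); exact: ft.
Qed.

Let push_incoming p (A : set (param R n m)) :
  (\forall e \near 0^'+, A ((push p).1, (push p).2 - e)) <->
  (\forall e \near 0^'+, A (push (p.1, p.2 - e))).
Proof.
exact: (@increasing_near_left _ (rho p.1) (fun y => A (p.1, y)) p.2).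
Qed.

Let push_outgoing p (A : set (param R n m)) :
  (\forall e \near 0^'+, A ((push p).1, (push p).2 + e)) <->
  (\forall e \near 0^'+, A (push (p.1, p.2 + e))).
Proof.
exact: (@increasing_near_right _ (rho p.1) (fun y => A (p.1, y)) p.2).
Qed.

(** The curves of [L'] and the image of [L] agree on the domain only; double
    points are interior, so this determines the velocity there. *)
Let push_velocity p q : double_pair (curve L) p q ->
  derive1 (fun t => F (1, curve L p.1 t)) p.2 =
  derive1 (rho p.1) p.2 *: velocity (curve L') (push p).
Proof.
move=> pq; rewrite /velocity -derive1_comp_scale; first last.
- by apply: smooth_differentiable; exact: curve_smooth.
- by apply: smooth_differentiable; case: rrho.
rewrite !derive1E; apply: near_eq_derive.
by apply: filterS (double_near_dom pq) => t /rhoP[].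
Qed.

(** The derivatives of [rho] by which the velocities differ are positive, so the
    sign is decided by [diffeotopy_sign]. *)
Let push_sign p q : double_pair (curve L) p q ->
  positive_crossing L' (push p) (push q) = positive_crossing L p q.
Proof.
move=> pq; have qp := double_pair_sym pq; have [dp dq _ e] := pq.
have sph r s : double_pair (curve L) r s ->
    \forall t \near r.2, sphere (curve L r.1 t).
  by move/double_near_dom; apply: filterS => t; exact: curve_sphere.
have dif (r : param R n m) : differentiable (curve L r.1) r.2.
  by apply: smooth_differentiable; exact: curve_smooth.
have := diffeotopy_sign dF (esym e) (sph _ _ qp) (sph _ _ pq) (dif _) (dif _).
rewrite (push_velocity pq) (push_velocity qp) areaZ.
have -> : F (1, curve L q.1 q.2) = at_param (curve L') (push p).
  by rewrite (rhoP dp).1 e.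
have rpos c t : 0 < derive1 (rho c) t by case: rrho.
rewrite (pmulr_rgt0 _ (mulr_gt0 (rpos _ _) (rpos _ _))) /positive_crossing e.
by apply; have := double_transverse qp.
Qed.

Let push_arc : exists f : arc L -> arc L',
  forall x p, sval x p -> sval (f x) (push p).
Proof.
suff /choice[f fP] : forall x : arc L, exists y : arc L',
    forall p, sval x p -> sval y (push p) by exists f.
move=> x; have [p xp] := arc_inhabited x.
have [y ye] := arc_through ((push_free p).2 (arc_free xp)).
exists y => q xq; rewrite ye; apply/push_linked.
by rewrite -(arc_linkedE xp).
Qed.

Let push_arcV : exists g : arc L' -> arc L,
  forall y p, sval y (push p) -> sval (g y) p.
Proof.
suff /choice[g gP] : forall y : arc L', exists x : arc L,
    forall p, sval y (push p) -> sval x p by exists g.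
move=> y; have [_ /[dup] /arc_free[/push_onto[p _ ->] _] yp] := arc_inhabited y.
have [x xe] := arc_through ((push_free p).1 (arc_free yp)).
exists x => q yq; rewrite xe; apply/push_linked.
by rewrite -(arc_linkedE yp).
Qed.

Lemma transport_iso :
  quandle_isomorphic (fundamental_quandle L) (fundamental_quandle L').
Proof.
have [f fP] := push_arc; have [g gP] := push_arcV.
apply: (@presented_quandle_iso _ _ (@crossing_relations _ _ _ L)
  (@crossing_relations _ _ _ L') (fun x => QGen (f x)) (fun y => QGen (g y))).
- move=> s t [p [q [x [y [z [pq xp yq zp [-> ->]]]]]]].
  apply: qeq_rel; exists (push p), (push q), (f x), (f y), (f z); split.
  + exact/push_crossing.
  + by apply/push_incoming; apply: filterS xp => e; exact: fP.
  + exact: fP.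
  + by apply/push_outgoing; apply: filterS zp => e; exact: fP.
  + by case: pq => pq _; rewrite push_sign //; case: ifP.
- move=> s t [p' [q' [x [y [z [pq xp yq zp [-> ->]]]]]]].
  have [[dp dq _ _] _] := pq.
  move: dp dq => /push_onto[p _ pE] /push_onto[q _ qE]; move: pq xp yq zp.
  rewrite {p'}pE {q'}qE.
  move=> /push_crossing pq /push_incoming xp yq /push_outgoing zp.
  apply: qeq_rel; exists p, q, (g x), (g y), (g z); split=> //.
  + by apply: filterS xp => e; exact: gP.
  + exact: gP.
  + by apply: filterS zp => e; exact: gP.
  + by case: pq => pq _; rewrite push_sign //; case: ifP.
- move=> x /=; have [p xp] := arc_inhabited x.
  by rewrite (arc_eq (gP _ _ (fP _ _ xp)) xp); exact: qeq_refl.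
- move=> y /=; have [p' yp] := arc_inhabited y.
  have [/push_onto[p _ pE] _] := arc_free yp; move: yp; rewrite pE => yp.
  by rewrite (arc_eq (fP _ _ (gP _ _ yp)) yp); exact: qeq_refl.
Qed.

End Isotopy.

Lemma isotopic_iso (R : realType) (n m : nat) (L L' : diagram R n m) :
  isotopic L L' ->
  quandle_isomorphic (fundamental_quandle L) (fundamental_quandle L').
Proof.
by move=> [F [rho [dF rrho rhoP]]]; exact: transport_iso dF rrho rhoP.
Qed.

(** * Crossings are isolated *)

Section Isolated.
Context (R : realType) (n m : nat).
Implicit Types (L : diagram R n m) (p q r : param R n m).

Lemma near_before (t : R) (P : set R) :
  (\forall u \near t, P u) -> \forall e \near 0^'+, P (t - e).
Proof.
move=> tP; apply/(nbhs_left0P t P); rewrite near_withinE.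
by near=> u => _; near: u.
Unshelve. all: by end_near. Qed.

Lemma near_after (t : R) (P : set R) :
  (\forall u \near t, P u) -> \forall e \near 0^'+, P (t + e).
Proof.
move=> tP; apply/(nbhs_right0P t P); rewrite near_withinE.
by near=> u => _; near: u.
Unshelve. all: by end_near. Qed.

Lemma immersion_locally_injective (V : normedModType R) (g : R -> V) (t : R) :
  differentiable g t -> derive1 g t != 0 -> \forall u \near t^', g u != g t.
Proof.
move=> /derivable1_diffP dg g0.
have cq : h^-1 *: (g (h *: 1 + t) - g t) @[h --> 0^'] --> derive1 g t.
  by rewrite derive1E; exact: dg.
have nq := cvgr_neq0 _ cq g0.
rewrite near_withinE; rewrite near_withinE in nq.
apply/(@nbhs0P R R^o (fun u => u != t -> g u != g t) t); near=> h => ht.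
have hq : h != 0 -> h^-1 *: (g (h *: 1 + t) - g t) != 0 by near: h; exact: nq.
have : h != 0 by apply: contra_neq ht => ->; rewrite addr0.
move=> /hq; apply: contra_neq; rewrite [h%:A]mulr1 addrC => ->.
by rewrite subrr scaler0.
Unshelve. all: by end_near. Qed.

(** Close to the parameter of a double point the curve misses the finitely many
    other double points by continuity, and does not return to this one because
    its velocity is nonzero. *)
Lemma crossing_isolated L p q : double_pair (curve L) p q ->
  exists2 d, 0 < d & forall t, 0 < `|t - p.2| < d -> free_param L (p.1, t).
Proof.
move=> pq; have [dp _ _ _] := pq.
have dg : differentiable (curve L p.1) p.2.
  by apply: smooth_differentiable; exact: curve_smooth.
have inj := immersion_locally_injective dg (curve_immersion L dp).
set X := [set x | exists p q, double_pair (curve L) p q /\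
  at_param (curve L) p = x].
have cX : closed (X `\ at_param (curve L) p).
  apply: (accessible_finite_set_closed.1
    (hausdorff_accessible (@norm_hausdorff _ _))).
  exact: sub_finite_set (@subDsetl _ _ _) (double_finite L).
have offX : \forall t \near p.2, ~ (X `\ at_param (curve L) p) (curve L p.1 t).
  have oX : nbhs (curve L p.1 p.2) (~` (X `\ at_param (curve L) p)).
    by apply: open_nbhs_nbhs; split; [exact: closed_openC | move=> [_]; apply].
  have cg := differentiable_continuous dg.
  exact: (cg _ oX).
have : \forall t \near p.2, t != p.2 -> free_param L (p.1, t).
  move: inj; rewrite near_withinE => inj; near=> t => tp; split.
    by near: t; exact: double_near_dom pq.
  move=> /under_double[r tr].
  have gt : curve L p.1 t != at_param (curve L) p by move: tp; near: t.
  suff : (X `\ at_param (curve L) p) (curve L p.1 t) by near: t.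
  by split; [exists (p.1, t), r | apply/eqP].
move=> /nbhs_ballP[d /= d0 dP]; exists d => // t /andP[tp td].
by apply: dP; [rewrite /ball /= distrC | rewrite -subr_eq0 -normr_gt0].
Unshelve. all: by end_near. Qed.

Lemma incoming_exists L p q : double_pair (curve L) p q ->
  exists x : arc L, incoming x p.
Proof.
move=> /crossing_isolated[d d0 dP].
have fr s : p.2 - d < s -> s < p.2 -> free_param L (p.1, s).
  by move=> ds sp; apply: dP; rewrite ltr0_norm; lra.
have [|x xE] := @arc_through _ _ _ L (p.1, p.2 - d / 2).
  by apply: fr; lra.
exists x; near=> e; rewrite xE; exists (p.2 - e); first exact: same_param_refl.
have e0 : 0 < e by near: e; exact: nbhs_right_gt.
have ed : e < d by near: e; exact: nbhs_right_lt.
by move=> s; rewrite /between /= => se; apply: fr; lra.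
Unshelve. all: by end_near. Qed.

Lemma outgoing_exists L p q : double_pair (curve L) p q ->
  exists x : arc L, outgoing x p.
Proof.
move=> /crossing_isolated[d d0 dP].
have fr s : p.2 < s -> s < p.2 + d -> free_param L (p.1, s).
  by move=> ps sd; apply: dP; rewrite gtr0_norm; lra.
have [|x xE] := @arc_through _ _ _ L (p.1, p.2 + d / 2).
  by apply: fr; lra.
exists x; near=> e; rewrite xE; exists (p.2 + e); first exact: same_param_refl.
have e0 : 0 < e by near: e; exact: nbhs_right_gt.
have ed : e < d by near: e; exact: nbhs_right_lt.
by move=> s; rewrite /between /= => se; apply: fr; lra.
Unshelve. all: by end_near. Qed.

Lemma incoming_unique L (x y : arc L) p : incoming x p -> incoming y p -> x = y.
Proof.
by move=> xp yp; have [e [/arc_eq]] := filter_ex (filterI xp yp); apply.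
Qed.

Lemma outgoing_unique L (x y : arc L) p : outgoing x p -> outgoing y p -> x = y.
Proof.
by move=> xp yp; have [e [/arc_eq]] := filter_ex (filterI xp yp); apply.
Qed.

End Isolated.

(** * A new crossing near an endpoint *)

(** [K'] has the same crossings as [K] and one more, at which the open component
    [i] passes under at time [t0]; nothing else happens between this passage and
    the endpoint ([e] tells whether that is the head).  This is all that the
    move means for the quandle. *)
Section EndCrossing.
Context (R : realType) (n m : nat) (K K' : diagram R n m).
Context (i : 'I_n) (e : bool) (t0 : R) (q : param R n m).
Let p : param R n m := (inl i, t0).
Let beyond (t : R) : bool := if e then t0 < t else t < t0.
Let tip : set (param R n m) := [set r | [/\ r.1 = inl i, dom r & beyond r.2]].
Hypothesis pq : crossing K' p q.
Hypothesis tip_q : ~ tip q.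
Hypothesis under_split :
  forall r, underpass K' r <-> underpass K r \/ r = p.
Hypothesis p_not_under : ~ underpass K p.
Hypothesis tip_not_under : forall r, tip r -> ~ underpass K r.
Hypothesis old_crossing : forall r s, crossing K r s ->
  [/\ crossing K' r s, positive_crossing K' r s = positive_crossing K r s,
      ~ tip r & ~ tip s].
Hypothesis new_crossing : forall r s, crossing K' r s -> r <> p ->
  crossing K r s.
Implicit Types r s : param R n m.

Let t01 : 0 < t0 < 1.
Proof. by case: pq => /double_interior. Qed.

(** The arcs of [K'] are cut out in those of [K] by removing [p]. *)
Let free_split r : free_param K' r <-> free_param K r /\ r <> p.
Proof.
split=> [[dr ur]|[[dr ur] rp]].
  split; last by move=> rp; apply/ur/under_split; right.
  by split=> // ur'; apply/ur/under_split; left.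
by split=> // /under_split[].
Qed.

Let tip_neq r : tip r -> r <> p.
Proof. by move=> [_ _ br] rp; move: br; rewrite rp /beyond ltxx; case: (e). Qed.

Let free_tip r : tip r -> free_param K' r.
Proof.
move=> tr; apply/free_split; split; last exact: tip_neq.
by split; [case: tr | exact: tip_not_under].
Qed.

Let not_tip r : dom r -> ~ tip r -> r <> p -> r.1 = inl i ->
  if e then r.2 < t0 else t0 < r.2.
Proof.
case: r => c t /= dt nt + ci; move: ci dt nt => -> dt nt tp.
have {}tp : t != t0 by apply: contra_not_neq tp => ->.
have : ~~ beyond t by apply/negP => bt; apply: nt.
by rewrite /beyond; case: (e); rewrite -leNgt lt_neqAle ?tp // eq_sym tp.
Qed.

Let linked_sub r s : linked K' r s -> linked K r s.
Proof. by move=> [t ts f]; exists t => // u /f/free_split[]. Qed.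

(** The segment between two points off the tip cannot contain [p], since beyond
    [p] there is only the tip. *)
Let linked_cut r s : free_param K' r -> free_param K' s -> ~ tip r -> ~ tip s ->
  linked K r s -> linked K' r s.
Proof.
move=> fr fs nr ns [t ts f]; exists t => // u btu; apply/free_split.
split; first exact: f.
move: r fr nr {f} ts btu => [c v] /= fr nr ts btu [cE uE]; subst c u.
move/same_param_open : ts fs ns => -> fs ns.
have [[dv _] /(not_tip dv nr)/(_ erefl) /= hv] := (free_split _).1 fr.
have [[dt _] /(not_tip dt ns)/(_ erefl) /= ht] := (free_split _).1 fs.
by move: btu hv ht; rewrite /between; case: (e) => /orP[]; lra.
Qed.

(** All points of the tip are linked to the endpoint, which has parameter 1 for
    a head and 0 for a leg. *)
Let tip_arc : exists x : arc K', sval x = tip.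
Proof.
pose o : param R n m := (inl i, e%:R).
have to : tip o.
  rewrite /tip /dom /beyond /=.
  by case: (e) t01 => /andP[? ?]; rewrite ?lexx ?ler01.
have [x xo] := arc_through (free_tip to); exists x; rewrite xo.
apply/seteqP; split=> r.
  move=> [t /same_param_open -> f] /=.
  have tt : between o.2 t t by rewrite /between lexx andbT le_total.
  split=> //; first by have [] := f _ tt.
  rewrite /beyond /=; have [_ _ /=] := to; rewrite /beyond /=.
  have : ~ between o.2 t t0 by move=> /f/free_split[_]; apply.
  rewrite /between /=; case: (e) => h1 h2; rewrite ltNge; apply/negP => h3;
    apply: h1; apply/orP; [right|left]; apply/andP; split=> //; exact: ltW.
case: r => c t [/= -> dt bt]; exists t; first exact: same_param_refl.
move=> s st; apply: free_tip; split=> //.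
  by move: st dt; rewrite /between /dom /o /=; case: (e) => /=; lra.
move: st bt to => + + [_ _]; rewrite /beyond /between /o /=.
by case: (e) => /=; lra.
Qed.

Let near_not_tip r : dom r -> ~ tip r -> r <> p ->
  \forall t \near r.2, ~ tip (r.1, t) /\ (r.1, t) <> p.
Proof.
move=> dr nr rp; have [ci|ci] := pselect (r.1 = inl i); last first.
  by near=> t; split; [move=> [] | move=> []].
have h := not_tip dr nr rp ci.
have : \forall t \near r.2, ~~ beyond t && (t != t0).
  move: h; rewrite /beyond; case: (e) => h; near=> t.
    by rewrite -leNgt andbC -lt_neqAle; near: t; exact: lt_nbhsl.
  by rewrite -leNgt eq_sym andbC -lt_neqAle; near: t; exact: lt_nbhsr.
apply: filterS => t /andP[nb tt]; split; first by move=> [_ _]; exact/negP.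
by move=> /(congr1 snd) /= /eqP; exact/negP.
Unshelve. all: by end_near. Qed.

(** The stem: the arc on the side of [p] away from the endpoint. *)
Let stem_arc : exists x : arc K', if e then incoming x p else outgoing x p.
Proof.
by case: (e); [apply: incoming_exists | apply: outgoing_exists];
  case: pq => [pq' _]; exact: pq'.
Qed.

(** The arc of [K] that contains the tip continues on the other side of [p],
    by isolation of crossings; the others do not meet the tip at all. *)
Let arc_off_tip (x : arc K) : exists r, [/\ sval x r, ~ tip r & r <> p].
Proof.
have [r xr] := arc_inhabited x.
have [[nr rp]|hr] := pselect (~ tip r /\ r <> p); first by exists r.
have ci : r.1 = inl i.
  apply: contrapT => ci; apply: hr; split; first by move=> [].
  by move=> rp; apply: ci; rewrite rp.
have br : beyond r.2 || (r.2 == t0).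
  have [dr _] := arc_free xr; apply/negPn/negP => /norP[nb tt]; apply: hr.
  by split=> [[_ _]|rp]; [exact/negP | move: tt; rewrite rp eqxx].
have [dr _] := arc_free xr.
have [d d0 dP] := crossing_isolated pq.1.
(* A point of the stem within the isolating distance of [p]. *)
pose t := if e then t0 - d / 2 else t0 + d / 2.
have ft : free_param K' (inl i, t).
  apply: (dP t); rewrite /t /=; case: (e).
    by rewrite ltr0_norm; lra.
  by rewrite gtr0_norm; lra.
exists (inl i, t); split; last first.
- by move=> /(congr1 snd) /=; rewrite /t; case: (e); lra.
- by move=> [_ _]; rewrite /beyond /t /=; case: (e); lra.
rewrite (arc_linkedE xr); exists t; first by rewrite ci; exact: same_param_refl.
move=> s st; rewrite ci.
have p_free : free_param K p by split; [case: pq.1 | exact: p_not_under].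
have [->//|st0] := eqVneq s t0.
(* The segment from [r] to the stem runs through the tip, then [p], which is
   no under-passage of [K], then the isolating neighbourhood. *)
have [bs|nbs] := boolP (beyond s).
  have ds : dom ((inl i, s) : param R n m).
    have [+ _] := ft; move: dr st; rewrite /between.
    by case: (r) ci => c v /= ->; rewrite /dom /=; lra.
  by split=> //; apply: tip_not_under.
have /free_split[] // : free_param K' (inl i, s).
apply: (dP s); rewrite normr_gt0 subr_eq0 st0 /=.
move: st nbs st0 br; rewrite /between /t /beyond; case: (e) => st.
  rewrite -leNgt le_eqVlt => /orP[->//|ss _ br]; rewrite ltr0_norm ?subr_lt0 //.
  by move: st br; lra.
rewrite -leNgt le_eqVlt eq_sym => /orP[->//|ss _ br].
rewrite gtr0_norm ?subr_gt0 //.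
by move: st br; lra.
Qed.

Let new_to_old : exists g : arc K' -> arc K,
  forall x r, sval x r -> sval (g x) r.
Proof.
suff /choice[g gP] : forall x : arc K', exists y : arc K,
    forall r, sval x r -> sval y r by exists g.
move=> x; have [r xr] := arc_inhabited x.
have [y yE] := arc_through ((free_split r).1 (arc_free xr)).1.
by exists y => s; rewrite yE (arc_linkedE xr); exact: linked_sub.
Qed.

Let old_to_new : exists f : arc K -> arc K',
  forall x r, sval x r -> ~ tip r -> r <> p -> sval (f x) r.
Proof.
suff /choice[f fP] : forall x : arc K, exists y : arc K',
    forall r, sval x r -> ~ tip r -> r <> p -> sval y r by exists f.
move=> x; have [r [xr nr rp]] := arc_off_tip x.
have fr : free_param K' r by apply/free_split; split=> //; exact: arc_free xr.
have [y yE] := arc_through fr; exists y => s xs ns sp; rewrite yE.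
apply: linked_cut => //; last by rewrite -(arc_linkedE xr).
by apply/free_split; split=> //; exact: arc_free xs.
Qed.

(** From [K] to [K'], a generator goes to its part off the tip.  Back, an arc
    goes to the arc that contains it, except the tip, which goes to the word [W]
    that the relation at [p] prescribes.  For a head the relation is
    [tip = stem ^ over]; for a leg the tip is the incoming arc, the relation is
    [stem = tip ^ over], and [W] uses the opposite exponent. *)
Lemma end_crossing_iso :
  quandle_isomorphic (fundamental_quandle K) (fundamental_quandle K').
Proof.
have [nu nuE] := tip_arc; have [om om_p] := stem_arc.
have [pq' up] := pq; have [dp dq _ _] := pq'.
have over r s : crossing K' r s -> ~ underpass K' s.
  by move=> [rs ur] us; exact: (under_over rs).1 ur us.
have [yq yqE] := arc_through (conj dq (over _ _ pq)).
have yq_q : sval yq q.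
  by rewrite yqE; apply: linked_refl; split=> //; exact: over pq.
have [g gP] := new_to_old; have [f fP] := old_to_new.
have nu_p : if e then outgoing nu p else incoming nu p.
  have near_dom := double_near_dom pq'.
  rewrite /outgoing /incoming nuE /tip /beyond.
  case: (e); near=> h; have h0 : 0 < h by [near: h; exact: nbhs_right_gt];
    split=> //=; rewrite ?ltrDl ?gtrBl // /p /=; near: h.
    exact: near_after near_dom.
  exact: near_before near_dom.
have off_nu x r : sval x r -> ~ tip r -> x <> nu.
  by move=> xr nr xnu; apply: nr; rewrite -nuE -xnu.
have off_p (x : arc K') r : sval x r -> r <> p.
  by move=> /arc_free/free_split[].
have fg x : x <> nu -> f (g x) = x.
  move=> xnu; have [r xr] := arc_inhabited x.
  have nr : ~ tip r by rewrite -nuE => nur; exact/xnu/(arc_eq xr).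
  exact: (arc_eq (fP _ _ (gP _ _ xr) nr (off_p _ _ xr)) xr).
have om_nu : om <> nu.
  move=> omnu; move: om_p; rewrite omnu /incoming /outgoing nuE /tip /beyond /=.
  case: (e) => /(filterI (nbhs_right_gt (0 : R)))/filter_ex[h /= [h0 [_ _]]];
    lra.
have yq_nu : yq <> nu by exact: off_nu yq_q tip_q.
pose b := positive_crossing K' p q.
pose W := qpow (if e then b else ~~ b) (QGen (g om)) (QGen (g yq)).
pose G x := if `[< x = nu >] then W else QGen (g x).
have Gnu : G nu = W by rewrite /G; case: asboolP.
have Goff x : x <> nu -> G x = QGen (g x) by rewrite /G; case: asboolP.
apply: (@presented_quandle_iso _ _ (@crossing_relations _ _ _ K)
  (@crossing_relations _ _ _ K') (fun x => QGen (f x)) G).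
- move=> _ _ [r [s [x [y [z [rs xr ys zr [-> ->]]]]]]].
  have [rs' sgn nr ns] := old_crossing rs.
  have rp : r <> p by move=> rp; apply: p_not_under; rewrite -rp; case: rs.
  have sp : s <> p by move=> sp; apply: (over _ _ rs'); rewrite sp.
  have dr : dom r by case: rs => -[].
  have nbr := near_not_tip dr nr rp.
  apply: qeq_rel; exists r, s, (f x), (f y), (f z); split; first exact: rs'.
  + apply: filterS2 xr (near_before nbr) => h xh [h1 h2]; exact: fP.
  + exact: fP.
  + apply: filterS2 zr (near_after nbr) => h xh [h1 h2]; exact: fP.
  + by rewrite sgn; case: ifP.
- move=> _ _ [r [s [x [y [z [rs xr ys zr [-> ->]]]]]]].
  have [rp|rp] := pselect (r = p).
    have qs : same_param q s.
      by apply: double_simple pq' _; rewrite -rp; case: rs.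
    have {ys} -> : y = yq by apply: (arc_eq ys); exact: arc_same_param qs yq_q.
    have -> : positive_crossing K' r s = b.
      by rewrite /b /positive_crossing rp (same_param_velocity K' qs).
    rewrite -!/(qpow _ _ _) qsubst_qpow /= (Goff yq) //.
    move: xr zr; rewrite rp => xr zr.
    case eb : (e); move: om_p nu_p; rewrite eb => om_p nu_p.
      rewrite (outgoing_unique zr nu_p) (incoming_unique xr om_p).
      rewrite Gnu (Goff om) //.
      by rewrite /W eb; exact: qeq_refl.
    rewrite (incoming_unique xr nu_p) (outgoing_unique zr om_p).
    rewrite Gnu (Goff om) //.
    rewrite /W eb -{1}(negbK b); apply: qeq_sym.
    exact: qeq_qpowK.
  have rs' := new_crossing rs rp; have [_ sgn nr ns] := old_crossing rs'.
  have dr : dom r by case: rs => -[].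
  have nbr := near_not_tip dr nr rp.
  have xnu : x <> nu.
    have [h [xh [nh _]]] := filter_ex (filterI xr (near_before nbr)).
    exact: off_nu xh nh.
  have znu : z <> nu.
    have [h [zh [nh _]]] := filter_ex (filterI zr (near_after nbr)).
    exact: off_nu zh nh.
  have ynu : y <> nu by exact: off_nu ys ns.
  apply: qeq_rel; exists r, s, (g x), (g y), (g z); split; first exact: rs'.
  + by apply: filterS xr => h; exact: gP.
  + exact: gP.
  + by apply: filterS zr => h; exact: gP.
  + by rewrite sgn /=; case: ifP => _ /=; rewrite !Goff.
- move=> x /=; have [r [xr nr rp]] := arc_off_tip x.
  have fxr := fP _ _ xr nr rp; rewrite Goff; last exact: off_nu fxr nr.
  by rewrite (arc_eq (gP _ _ fxr) xr); exact: qeq_refl.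
- move=> x; have [->|xnu] := pselect (x = nu); last first.
    by rewrite Goff //= fg //; exact: qeq_refl.
  rewrite Gnu qsubst_qpow /= !fg //; case eb : (e);
    move: om_p nu_p; rewrite eb => om_p nu_p.
    by apply/qeq_sym/qeq_rel; exists p, q, om, yq, nu.
  apply: qeq_trans (qeq_qpowK _ b _ (QGen yq)).
  by apply: qeq_qpow; apply: qeq_rel; exists p, q, nu, yq, om.
Unshelve. all: by end_near. Qed.

End EndCrossing.

(** * The forbidden move *)

Section Agreement.
Context (R : realType) (n m : nat).
Implicit Types (K L : diagram R n m) (A : set (param R n m)).
Implicit Types (p q r s : param R n m).

Definition agree_off A K L : Prop := forall p, dom p -> ~ A p ->
  at_param (curve L) p = at_param (curve K) p /\
  (underpass L p <-> underpass K p).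

Lemma agree_off_sym A K L : agree_off A K L -> agree_off A L K.
Proof.
by move=> KL p dp Ap; have [-> h] := KL p dp Ap; split=> //; split=> /h.
Qed.

Lemma agree_off_crossing A K L r s : agree_off A K L -> ~ A r -> ~ A s ->
  crossing K r s -> crossing L r s.
Proof.
move=> KL Ar As [[dr ds nrs rs] ur].
have [er hr] := KL r dr Ar; have [es _] := KL s ds As.
by split; [split=> //; rewrite er es | apply/hr].
Qed.

(** Velocities need agreement in a neighbourhood, hence the condition on nearby
    parameters; at the double point itself the domain is a neighbourhood. *)
Lemma agree_off_velocity A K L r s : agree_off A K L ->
  (\forall t \near r.2, ~ A (r.1, t)) -> double_pair (curve K) r s ->
  velocity (curve L) r = velocity (curve K) r.
Proof.
move=> KL nA rs; rewrite /velocity !derive1E; apply: near_eq_derive.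
apply: filterS2 nA (double_near_dom rs) => t At dt.
by have [] := KL _ dt At.
Qed.

Lemma agree_off_sign A K L r s : agree_off A K L ->
  (\forall t \near r.2, ~ A (r.1, t)) -> (\forall t \near s.2, ~ A (s.1, t)) ->
  crossing K r s -> positive_crossing L r s = positive_crossing K r s.
Proof.
move=> KL nr ns [rs _]; rewrite /positive_crossing.
rewrite (agree_off_velocity KL nr rs).
rewrite (agree_off_velocity KL ns (double_pair_sym rs)).
have [dr _ _ _] := rs.
have Ar : ~ A r by case: (r) (nbhs_singleton nr).
by have [-> _] := KL r dr Ar.
Qed.

End Agreement.

Lemma near_not_end_interval (R : realType) (e : bool) (a t : R) :
  0 < a < 1 -> 0 <= t <= 1 -> ~ end_interval e a t ->
  \forall u \near t, ~ end_interval e a u.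
Proof.
rewrite /end_interval; case: e => a01 t01 /= nt.
  have ta : t < a by rewrite ltNge; apply/negP => at_; apply: nt; lra.
  near=> u; have : u < a by near: u; exact: lt_nbhsl.
  by move=> ua /andP[]; lra.
have at_ : a < t by rewrite ltNge; apply/negP => ta; apply: nt; lra.
near=> u; have : a < u by near: u; exact: lt_nbhsr.
by move=> ua /andP[]; lra.
Unshelve. all: by end_near. Qed.

(** Of the picture in the disc only its passages matter: the end piece [I] has
    no crossing in [K] and only [p] in [K'], the strand over [p] lies outside
    [I], and [I] is closed, so that the diagrams agree near every point off
    [I]. *)
Lemma under_pull_iso (R : realType) (n m : nat) (K K' : diagram R n m) :
  under_pull K K' ->
  quandle_isomorphic (fundamental_quandle K) (fundamental_quandle K').
Proof.
move=> [i [e [a [j [b [c [h]]]]]]] /=.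
set I : set (param R n m) := stretch (inl i) _.
set J : set (param R n m) := stretch j _.
move=> [a01 _ IJ _ [_ _ KK' noK [p [q [Ip Jq pq onlypq]]]]].
have IE r : I r <-> r.1 = inl i /\ end_interval e a r.2.
  split=> [[t Tt /same_param_open ->]|] //.
  by case: r => d t /= [-> Tt]; exists t => //; exact: same_param_refl.
have nIJ r : I r -> ~ J r.
  by move=> Ir Jr; have : (I `&` J) r by []; rewrite IJ.
have Isame r s : I r -> same_param r s -> s = r.
  by move=> /IE[]; case: r => d t /= -> _; exact: same_param_open.
have agree : agree_off I K K' by [].
have crossK r s : crossing K r s -> ~ I r /\ ~ I s.
  move=> [rs _]; split=> Ir; first by apply: noK rs _; left.
  by apply: noK (double_pair_sym rs) _; left.
have under_dom (L : diagram R n m) r : underpass L r -> dom r.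
  by move=> /under_double[s [dr _ _ _]].
have over r s : crossing K' r s -> ~ underpass K' s.
  by move=> [rs ur] us; exact: (under_over rs).1 ur us.
have noKI r : I r -> ~ underpass K r.
  by move=> Ir /under_double[s rs]; apply: noK rs _; left.
have onlyp r s : double_pair (curve K') r s -> I r -> r = p.
  move=> rs Ir; have [|rp|rq] := onlypq _ _ rs; first by left.
    by rewrite (Isame _ _ Ir rp).
  by have := Isame _ _ Ir rq => qr; case: (nIJ r Ir); rewrite -qr.
have /IE[pi pT] := Ip.
have pE : p = (inl i, p.2) by rewrite -pi; case: (p).
have under_split r : underpass K' r <-> underpass K r \/ r = p.
  have [Ir|nIr] := pselect (I r).
    split=> [/under_double[s rs]|[ur|->]]; last by case: pq.
      by right; exact: onlyp rs Ir.
    by case: (noKI r Ir).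
  split=> [ur|[ur|rp]]; last by rewrite rp in nIr.
    by left; apply/(agree r (under_dom _ _ ur) nIr).2.
  by apply/(agree r (under_dom _ _ ur) nIr).2.
have tipI r :
    [/\ r.1 = inl i, dom r & if e then p.2 < r.2 else r.2 < p.2] -> I r.
  move=> [ri dr br]; apply/IE; split=> //; move: pT dr br.
  case: r ri => d t /= ->; rewrite /end_interval /dom /=.
  by case: (e) => /=; lra.
have nearI r s (L : diagram R n m) : double_pair (curve L) r s -> ~ I r ->
    \forall t \near r.2, ~ I (r.1, t).
  move=> [dr _ _ _] nIr; have [ri|ri] := pselect (r.1 = inl i); last first.
    by near=> t => /IE[].
  have rT : ~ end_interval e a r.2 by move=> rT; apply: nIr; apply/IE.
  have r01 : 0 <= r.2 <= 1 by case: r ri dr {nIr rT} => d t /= ->.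
  by apply: filterS (near_not_end_interval a01 r01 rT) => t nt /IE[].
apply: (@end_crossing_iso _ _ _ K K' i e p.2 q); rewrite -?pE //.
- by move=> /tipI Iq; exact: nIJ Iq Jq.
- exact: noKI.
- by move=> r /tipI; exact: noKI.
- move=> r s rs; have [nr ns] := crossK _ _ rs.
  split; [exact: agree_off_crossing agree nr ns rs | | by move/tipI
    | by move/tipI].
  have [rs' _] := rs.
  apply: agree_off_sign agree _ _ rs; first exact: nearI rs' nr.
  exact: nearI (double_pair_sym rs') ns.
- move=> r s rs rp; have [rs' ur] := rs.
  have nr : ~ I r by move=> Ir; exact/rp/(onlyp _ _ rs').
  have ns : ~ I s.
    move=> Is; apply: (over _ _ rs).
    by rewrite (onlyp _ _ (double_pair_sym rs') Is); case: pq.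
  exact: agree_off_crossing (agree_off_sym agree) nr ns rs.
Unshelve. all: by end_near. Qed.

Theorem lemma3p4 (R : realType) (n m : nat) (L L' : diagram R n m) :
  under_forbidden_move L L' ->
  quandle_isomorphic (fundamental_quandle L) (fundamental_quandle L').
Proof.
move=> [K [K' [LK LK' KK']]].
apply: (quandle_isomorphic_trans (isotopic_iso LK)).
apply: (quandle_isomorphic_trans _ (quandle_isomorphic_sym (isotopic_iso LK'))).
by case: KK' => /under_pull_iso // /quandle_isomorphic_sym.
Qed.
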